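(* Let $a,b$ be non-negative integers, and let $T_b\subset\mathcal{A}$ be the $\mathbf{Z}_2$-span of all admissible $Sq^I$ with $i_1\le b$. Then $Sq^a\,T_b\subset T_n$, where $$ n=\begin{cases} a&\text{if } a\ge 2b,\\ 2b-1&\text{if } 2b>a\ge b,\\ a+b&\text{if } b>a>0. \end{cases} $$
   Context: $\mathcal{A}$ is the mod 2 Steenrod algebra and $\mathbf{Z}_2$ is the integers mod 2. For a finite sequence of positive integers $I=(i_1,\ldots,i_k)$, $Sq^I=Sq^{i_1}Sq^{i_2}\cdots Sq^{i_k}$; $I$ (or $Sq^I$) is admissible if $i_s\ge 2i_{s+1}$ for all $1\le s<k$. The empty sequence is admissible, has $Sq^I=1$, and is counted as satisfying $i_1\le b$ for every $b\ge 0$, so $1\in T_b$. $Sq^a\,T_b$ denotes $\{Sq^a x: x\in T_b\}$, the product being taken in $\mathcal{A}$. *)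

(* Defs.v *)
From HB Require Import structures.
From mathcomp Require Import all_boot all_algebra.
From mathcomp Require Import generic_quotient ring_quotient.
From mathcomp Require Import boolp classical_sets.
From mathcomp Require Import monalg.

Set Implicit Arguments.
Unset Strict Implicit.
Unset Printing Implicit Defensive.

Import GRing.Theory.

Local Open Scope classical_set_scope.
Local Open Scope ring_scope.
Local Open Scope quotient_scope.

(** * The mod 2 Steenrod algebra

    The unital associative ['F_2]-algebra generated by [Sq 0, Sq 1, ...],
    subject to [Sq 0 = 1] and to the Adem relations. *)

(* Monoid algebra of the free monoid on [nat], i.e. noncommutative polynomials
   over 'F_2 in variables indexed by [nat]. *)
Definition freeSq : nzRingType := {malg 'F_2[{fmonom nat}]}.

Definition genSq (i : nat) : freeSq := << fmu i >>.

(* The subtractions of natural numbers are not truncated when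
   [0 < a < 2 * b] and [j <= a./2]. *)
Definition adem_rel (a b : nat) : freeSq :=
  genSq a * genSq b
  - \sum_(j < (a./2).+1)
      (genSq (a + b - j) * genSq j) *+ 'C(b - 1 - j, a - 2 * j).

Inductive steenrod_rel : freeSq -> Prop :=
| Rel_unit : steenrod_rel (genSq 0 - 1)
| Rel_adem (a b : nat) of (0 < a < 2 * b)%N : steenrod_rel (adem_rel a b).

(* The two-sided ideal generated by the relations. *)
Inductive steenrod_ideal_spec : freeSq -> Prop :=
| Ideal_rel x of steenrod_rel x : steenrod_ideal_spec x
| Ideal_0 : steenrod_ideal_spec 0
| Ideal_sub x y of steenrod_ideal_spec x & steenrod_ideal_spec y :
    steenrod_ideal_spec (x - y)
| Ideal_mull u x of steenrod_ideal_spec x : steenrod_ideal_spec (u * x)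
| Ideal_mulr u x of steenrod_ideal_spec x : steenrod_ideal_spec (x * u).

Definition steenrod_ideal (x : freeSq) : bool := `[< steenrod_ideal_spec x >].

Lemma steenrod_idealP x : reflect (steenrod_ideal_spec x) (x \in steenrod_ideal).
Proof. exact: asboolP. Qed.

Lemma steenrod_ideal_zmod_closed : zmod_closed steenrod_ideal.
Proof.
split=> [|x y /steenrod_idealP Ix /steenrod_idealP Iy].
- exact/steenrod_idealP/Ideal_0.
- exact/steenrod_idealP/Ideal_sub.
Qed.

HB.instance Definition _ :=
  GRing.isZmodClosed.Build freeSq steenrod_ideal steenrod_ideal_zmod_closed.

Lemma steenrod_idealMl u x : x \in steenrod_ideal -> u * x \in steenrod_ideal.
Proof. by move=> /steenrod_idealP ?; apply/steenrod_idealP/Ideal_mull. Qed.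

Lemma steenrod_idealMr u x : x \in steenrod_ideal -> x * u \in steenrod_ideal.
Proof. by move=> /steenrod_idealP ?; apply/steenrod_idealP/Ideal_mulr. Qed.

Section Augmentation.

Definition augmentation_fmonom (m : {fmonom nat}) : 'F_2 :=
  (all (pred1 0%N) m)%:R.

Lemma augmentation_fmonom_mmorphism : mmorphism augmentation_fmonom.
Proof.
split=> [m1 m2|]; rewrite /augmentation_fmonom; last by rewrite fm1.
by rewrite fmM all_cat -natrM mulnb.
Qed.

HB.instance Definition _ :=
  isMultiplicative.Build {fmonom nat} 'F_2 augmentation_fmonom
    augmentation_fmonom_mmorphism.

Definition augmentation : {rmorphism freeSq -> 'F_2} :=
  mmap idfun augmentation_fmonom.

Lemma augmentation_genSq i : augmentation (genSq i) = (i == 0)%:R.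
Proof. by rewrite /= mmapU /= mul1r /augmentation_fmonom fmU /= andbT. Qed.

Lemma steenrod_ideal_augmentation x : x \in steenrod_ideal -> augmentation x = 0.
Proof.
move=> /steenrod_idealP; elim=> {x}.
- move=> _ [|a b /andP[a0 _]].
    by rewrite rmorphB rmorph1 augmentation_genSq subrr.
  rewrite /adem_rel rmorphB rmorphM !augmentation_genSq eqn0Ngt a0 mul0r.
  rewrite rmorph_sum big1 ?subrr// => j _.
  have ltj : (j < a + b)%N.
    rewrite ltn_addr// (leq_ltn_trans (leq_ord j))//.
    by rewrite -divn2 ltn_Pdiv.
  by rewrite rmorphMn rmorphM !augmentation_genSq subn_eq0 leqNgt ltj mul0r mul0rn.
- exact: rmorph0.
- by move=> x y _ x0 _ y0; rewrite rmorphB x0 y0 subrr.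
- by move=> u x _ x0; rewrite rmorphM x0 mulr0.
- by move=> u x _ x0; rewrite rmorphM x0 mul0r.
Qed.

End Augmentation.

Lemma steenrod_ideal1 : 1 \notin steenrod_ideal.
Proof.
apply/negP => /steenrod_ideal_augmentation/eqP.
by rewrite rmorph1 oner_eq0.
Qed.

Definition steenrod : Type :=
  Quotient.quot (GRing.ZmodClosed.clone freeSq steenrod_ideal _).

HB.instance Definition _ := ZmodQuotient.on steenrod.

Section SteenrodAlgebra.

Implicit Types (x y z : steenrod) (c d : 'F_2).

Definition steenrod_mul : steenrod -> steenrod -> steenrod :=
  lift_op2 steenrod *%R.

Definition steenrod_scale c : steenrod -> steenrod :=
  lift_op1 steenrod ( *:%R c).

Lemma eq_steenrod (u v : freeSq) :
  (u = v %[mod steenrod]) <-> (u - v \in steenrod_ideal).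
Proof. by rewrite Quotient.idealrBE; split=> /eqP. Qed.

Lemma pi_steenrodM :
  {morph \pi_steenrod : u v / u * v >-> steenrod_mul u v}.
Proof.
move=> u v; unlock steenrod_mul; apply/eq_steenrod.
set u' := repr _; set v' := repr _.
have -> : u * v - u' * v' = u * (v - v') + (u - u') * v'.
  by rewrite mulrBr mulrBl addrA subrK.
apply: rpredD.
- by apply: steenrod_idealMl; apply/eq_steenrod; rewrite reprK.
- by apply: steenrod_idealMr; apply/eq_steenrod; rewrite reprK.
Qed.

Lemma pi_steenrodZ c :
  {morph \pi_steenrod : u / c *: u >-> steenrod_scale c u}.
Proof.
move=> u; unlock steenrod_scale; apply/eq_steenrod.
rewrite -scalerBr -mul_malgC.
by apply: steenrod_idealMl; apply/eq_steenrod; rewrite reprK.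
Qed.

Let piM := pi_steenrodM.
Let piZ := pi_steenrodZ.
Let piD : {morph \pi_steenrod : u v / u + v} := raddfD \pi_steenrod.

Lemma steenrod_mulA : associative steenrod_mul.
Proof.
by elim/quotW=> x; elim/quotW=> y; elim/quotW=> z; rewrite -!piM mulrA.
Qed.

Lemma steenrod_mul1l : left_id (\pi_steenrod 1) steenrod_mul.
Proof. by elim/quotW=> x; rewrite -!piM mul1r. Qed.

Lemma steenrod_mul1r : right_id (\pi_steenrod 1) steenrod_mul.
Proof. by elim/quotW=> x; rewrite -!piM mulr1. Qed.

Lemma steenrod_mulDl : left_distributive steenrod_mul +%R.
Proof.
elim/quotW=> x; elim/quotW=> y; elim/quotW=> z.
by rewrite -!(piM, piD) mulrDl.
Qed.

Lemma steenrod_mulDr : right_distributive steenrod_mul +%R.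
Proof.
elim/quotW=> x; elim/quotW=> y; elim/quotW=> z.
by rewrite -!(piM, piD) mulrDr.
Qed.

Lemma steenrod_one_neq0 : \pi_steenrod 1 != 0.
Proof.
rewrite -(raddf0 \pi_steenrod); apply/eqP => /eq_steenrod.
by rewrite subr0; apply/negP/steenrod_ideal1.
Qed.

HB.instance Definition _ := GRing.Zmodule_isNzRing.Build steenrod
  steenrod_mulA steenrod_mul1l steenrod_mul1r
  steenrod_mulDl steenrod_mulDr steenrod_one_neq0.

HB.instance Definition _ := @isNzRingQuotient.Build
  freeSq (Quotient.equiv (GRing.ZmodClosed.clone freeSq steenrod_ideal _))
  0 -%R +%R 1 *%R steenrod (erefl _) pi_steenrodM.

Lemma steenrod_scaleA c d x :
  steenrod_scale c (steenrod_scale d x) = steenrod_scale (c * d) x.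
Proof. by elim/quotW: x => x; rewrite -!piZ scalerA. Qed.

Lemma steenrod_scale1 : left_id 1 steenrod_scale.
Proof. by elim/quotW=> x; rewrite -!piZ scale1r. Qed.

Lemma steenrod_scaleDr : right_distributive steenrod_scale +%R.
Proof.
by move=> c; elim/quotW=> x; elim/quotW=> y; rewrite -!(piZ, piD) scalerDr.
Qed.

Lemma steenrod_scaleDl x :
  {morph steenrod_scale^~ x : c d / c + d >-> c + d}.
Proof. by move=> c d; elim/quotW: x => x; rewrite -!(piZ, piD) scalerDl. Qed.

HB.instance Definition _ := GRing.Zmodule_isLmodule.Build 'F_2 steenrod
  steenrod_scaleA steenrod_scale1 steenrod_scaleDr steenrod_scaleDl.

Lemma steenrod_scaleAl c x y : c *: (x * y) = (c *: x) * y.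
Proof.
elim/quotW: x => x; elim/quotW: y => y.
rewrite -[LHS]/(steenrod_scale c (steenrod_mul _ _)).
rewrite -[RHS]/(steenrod_mul (steenrod_scale c _) _).
by rewrite -!(piM, piZ) -!mul_malgC mulrA.
Qed.

HB.instance Definition _ :=
  GRing.Lmodule_isLalgebra.Build 'F_2 steenrod steenrod_scaleAl.

Lemma steenrod_scaleAr c x y : c *: (x * y) = x * (c *: y).
Proof.
have [-> | ->] : c = 0 \/ c = 1; last by rewrite !scale1r.
- by case: c => [[|[|//]] ?]; [left | right]; apply: val_inj.
- by rewrite !scale0r mulr0.
Qed.

HB.instance Definition _ :=
  GRing.Lalgebra_isAlgebra.Build 'F_2 steenrod steenrod_scaleAr.

End SteenrodAlgebra.

Definition Sq (i : nat) : steenrod := \pi_steenrod (genSq i).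

Lemma Sq0 : Sq 0 = 1.
Proof.
rewrite -(rmorph1 \pi_steenrod); apply/eq_steenrod/steenrod_idealP.
exact/Ideal_rel/Rel_unit.
Qed.

Lemma Sq_adem (a b : nat) : (0 < a < 2 * b)%N ->
  Sq a * Sq b =
  \sum_(j < (a./2).+1) (Sq (a + b - j) * Sq j) *+ 'C(b - 1 - j, a - 2 * j).
Proof.
move=> ab; transitivity (\pi_steenrod (genSq a * genSq b)).
  by rewrite rmorphM.
transitivity (\pi_steenrod (\sum_(j < (a./2).+1)
    (genSq (a + b - j) * genSq j) *+ 'C(b - 1 - j, a - 2 * j))).
  exact/eq_steenrod/steenrod_idealP/Ideal_rel/Rel_adem.
by rewrite rmorph_sum; apply: eq_bigr => j _; rewrite rmorphMn rmorphM.
Qed.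

(** * Admissible monomials *)

Definition SqI (I : seq nat) : steenrod := \prod_(i <- I) Sq i.

Definition admissible (I : seq nat) : bool :=
  all (leq 1) I && sorted (fun i j => 2 * j <= i)%N I.

Definition linear_span (R : nzRingType) (V : lmodType R) (B : set V) : set V :=
  [set x | exists (n : nat) (c : 'I_n -> R) (v : 'I_n -> V),
     (forall i, B (v i)) /\ x = \sum_(i < n) c i *: v i].

(* [head 0 I] is the first entry of [I], and [0] when [I] is empty. *)
Definition T (b : nat) : set steenrod :=
  linear_span [set SqI I | I in [set I | admissible I /\ (head 0 I <= b)%N]].

(* Main.v *)
Require Import Defs.
From mathcomp Require Import all_boot all_algebra.
From mathcomp Require Import classical_sets.
From mathcomp Require Import zify.

Set Implicit Arguments.
Unset Strict Implicit.

Local Open Scope classical_set_scope.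
Local Open Scope ring_scope.

Import GRing.Theory.

(** The three cases of the proposition are [Sq a * T b `<=` T (adem_bound a b)]
    for a single function [adem_bound], and this is proved by strong induction
    on [b] ([Sq_mul_T]). By linearity it suffices to multiply an admissible
    monomial [Sq i * y], with [i <= b] and [y] in [T (i./2)]. If [2 * i <= a],
    the product is already admissible, and [Sq 0] is the identity. Otherwise the
    Adem relation rewrites it as a sum of terms [Sq (a + i - j) * (Sq j * y)]
    with [2 * j <= a].

    The induction works because both multiplications left to do in such a term
    act on spans of index less than [i]. The product [Sq j * y] starts from
    [T (i./2)], and it lands in some [T c] with
    - [c = i - 1] when [i <= a], whereas
    - [c = j + i./2 <= (a + i) / 2 < i] when [a < i].

    Since [a + i - j >= i > c], the second product is in the range where the
    bound is [maxn (a + i - j) (2 * c - 1)]. The value [2 * c - 1] is always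
    small enough. The value [a + i - j] is at most [a + i], which suffices when
    [a < i]; when [i <= a] the Adem coefficient vanishes unless
    [a - i + 1 <= j], so that [a + i - j <= 2 * i - 1]. *)

Section LinearSpan.
Context {R : nzRingType} {V : lmodType R}.
Implicit Types (B : set V) (P : V -> Prop).

(** A span is the least submodule containing its generators, so a property
    stable under linear combinations need only be checked on the generators. *)
Lemma linear_span_ind B P : P 0 -> (forall x y, P x -> P y -> P (x + y)) ->
  (forall c x, P x -> P (c *: x)) -> B `<=` P -> linear_span B `<=` P.
Proof.
move=> P0 PD PZ BP x [n [c [v [Bv ->]]]].
by apply: big_ind => // i _; apply/PZ/BP.
Qed.

Lemma sub_linear_span B : B `<=` linear_span B.
Proof.
move=> x Bx; exists 1%N, (fun=> 1), (fun=> x); split=> //.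
by rewrite big_ord1 scale1r.
Qed.

Lemma linear_span0 B : linear_span B 0.
Proof.
by exists 0%N, (fun=> 0), (fun=> 0); split=> [[]//|]; rewrite big_ord0.
Qed.

Lemma linear_spanD B x y :
  linear_span B x -> linear_span B y -> linear_span B (x + y).
Proof.
move=> [m [c [v [Bv ->]]]] [n [d [w [Bw ->]]]].
exists (m + n)%N,
  (fun i => match split i with inl j => c j | inr k => d k end),
  (fun i => match split i with inl j => v j | inr k => w k end).
split=> [i|]; first by case: split.
rewrite big_split_ord /=; congr (_ + _); apply: eq_bigr => i _.
  by rewrite (unsplitK (inl i : 'I_m + 'I_n)).
by rewrite (unsplitK (inr i : 'I_m + 'I_n)).
Qed.

Lemma linear_spanZ B c x : linear_span B x -> linear_span B (c *: x).
Proof.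
move=> [n [d [v [Bv ->]]]]; exists n, (fun i => c * d i), v; split=> //.
by rewrite scaler_sumr; apply: eq_bigr => i _; rewrite scalerA.
Qed.

Lemma linear_span_subset B1 B2 :
  B1 `<=` B2 -> linear_span B1 `<=` linear_span B2.
Proof.
move=> B12; apply: linear_span_ind; first exact: linear_span0.
- exact: linear_spanD.
- exact: linear_spanZ.
- by move=> x /B12; apply: sub_linear_span.
Qed.

End LinearSpan.

Lemma T_le b c : (b <= c)%N -> T b `<=` T c.
Proof.
move=> bc; apply: linear_span_subset => _ [I [admI Ib] <-].
by exists I => //; split=> //; apply: leq_trans bc.
Qed.

Lemma SqI_T (I : seq nat) b : admissible I -> (head 0%N I <= b)%N ->
  T b (SqI I).
Proof. by move=> admI Ib; apply: sub_linear_span; exists I. Qed.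

Lemma T0 b : T b 0. Proof. exact: linear_span0. Qed.

Lemma T_add b x y : T b x -> T b y -> T b (x + y).
Proof. exact: linear_spanD. Qed.

Lemma T_muln b x n : T b x -> T b (x *+ n).
Proof. by move=> Tx; rewrite -scaler_nat; apply: linear_spanZ. Qed.

Lemma SqI_cons i (I : seq nat) : SqI (i :: I) = Sq i * SqI I.
Proof. by rewrite /SqI big_cons. Qed.

Lemma admissible_cons i (I : seq nat) :
  admissible (i :: I) = [&& (0 < i)%N, (2 * head 0%N I <= i)%N & admissible I].
Proof.
rewrite /admissible; case: I => [|j I] /=;
  by case: (_ < i)%N; case: (_ <= i)%N; rewrite /= ?andbF.
Qed.

Lemma Sq_mul_SqI_T a (I : seq nat) : admissible I ->
  (2 * head 0%N I <= a)%N -> T a (Sq a * SqI I).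
Proof.
case: a => [|a] admI Ia; first by rewrite Sq0 mul1r; apply: SqI_T => //; lia.
by rewrite -SqI_cons; apply: SqI_T => //=; rewrite admissible_cons admI Ia.
Qed.

(** The index [n] of the proposition: the maximum is [a] when [2 * b <= a] and
    [2 * b - 1] when [b <= a < 2 * b]. *)
Definition adem_bound (a b : nat) : nat :=
  if (b <= a)%N then maxn a (2 * b - 1) else (a + b)%N.

Lemma adem_bound_le a b c : (b <= c)%N -> (adem_bound a b <= adem_bound a c)%N.
Proof. by rewrite /adem_bound; do !case: ifP => ?; lia. Qed.

Lemma adem_bound_gel a b : (a <= adem_bound a b)%N.
Proof. by rewrite /adem_bound; do !case: ifP => ?; lia. Qed.

Lemma adem_bound_ger a b : (b <= adem_bound a b)%N.
Proof. by rewrite /adem_bound; case: ifP => ?; lia. Qed.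

(** The arithmetic of one Adem term [Sq (a + i - j) * (Sq j * y)] with [y] in
    [T (i./2)]: the product [Sq j * y] has a bound [c < i], and multiplying by
    [Sq (a + i - j)] does not exceed the bound for [Sq a * Sq i * y]. The
    hypothesis [a - 2 * j <= i - 1 - j] holds exactly when the integer binomial
    coefficient of the term is nonzero. *)
Lemma adem_bound_term a i j : (a < 2 * i)%N -> (2 * j <= a)%N ->
  (a - 2 * j <= i - 1 - j)%N ->
  (adem_bound j i./2 < i)%N /\
  (adem_bound (a + i - j) (adem_bound j i./2) <= adem_bound a i)%N.
Proof. by rewrite /adem_bound; do !case: ifP => ?; lia. Qed.

Lemma Sq_mul_T a b x : T b x -> T (adem_bound a b) (Sq a * x).
Proof.
elim/ltn_ind: b a x => b IHb a.
apply: linear_span_ind => [|x y|c x|_ [I [admI Ib] <-]].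
- by rewrite mulr0; apply: T0.
- by rewrite mulrDr; apply: T_add.
- by rewrite -scalerAr; apply: linear_spanZ.
(* The Adem relation is for [a < 2 * i]; beyond it the product is admissible. *)
have [Ia|aI] := leqP (2 * head 0%N I) a.
  exact: T_le (adem_bound_gel a b) _ (Sq_mul_SqI_T admI Ia).
case: I admI Ib aI => [|i I]; first by move=> _ _ /=; lia.
rewrite admissible_cons => /and3P[i_gt0 Ii admI] /= ib ai.
rewrite SqI_cons.
have [->|a_gt0] := posnP a.
  rewrite Sq0 mul1r -SqI_cons; apply: SqI_T; last first.
    exact: leq_trans ib (adem_bound_ger _ _).
  by rewrite admissible_cons i_gt0 Ii.
apply: T_le (adem_bound_le a ib) _ _.
rewrite mulrA Sq_adem ?a_gt0// mulr_suml; apply: big_ind => [||j _].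
- exact: T0.
- exact: T_add.
have [gt_coef|le_coef] := ltnP (i - 1 - j) (a - 2 * j).
  by rewrite bin_small// mulr0n mul0r; apply: T0.
have ja : (2 * j <= a)%N by have := ltn_ord j; lia.
have [c_lt_i le_bound] := adem_bound_term ai ja le_coef.
rewrite mulrnAl -mulrA; apply/T_muln/(T_le le_bound).
apply: (IHb); first exact: leq_trans ib.
by apply: IHb; [lia | apply: SqI_T => //; lia].
Qed.

Theorem proposition1p3 (a b : nat) :
  [/\ (2 * b <= a)%N -> [set Sq a * x | x in T b] `<=` T a,
      (b <= a < 2 * b)%N -> [set Sq a * x | x in T b] `<=` T (2 * b - 1)
    & (0 < a < b)%N -> [set Sq a * x | x in T b] `<=` T (a + b)].
Proof.
have Sq_sub n : (adem_bound a b <= n)%N -> [set Sq a * x | x in T b] `<=` T n.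
  by move=> le_n _ [x Tx <-]; apply: T_le le_n _ (Sq_mul_T a Tx).
by split=> ab; apply: Sq_sub; rewrite /adem_bound; case: ifP => ?; lia.
Qed.
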